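(* Let $R(x)=\sum_{d=1}^{d_{\max}} R_d x^d$ be a generator degree distribution, fix $r=m/n>0$, and let $l_{\mathrm{avg}} = \frac{n}{m}R'(1)$ and $\lambda(x)=e^{l_{\mathrm{avg}}(x-1)}$. Suppose transmission takes place over the binary erasure channel with erasure probability $\epsilon\in(0,1)$. Then the error floor $P_e$ of the $(\lambda(x),R(x))$ LDGM ensemble satisfies $$P_e \;\ge\; \frac{1}{2}\,\lambda(\epsilon)\Bigl(1+ l_{\mathrm{avg}}\, (1-\epsilon)\Bigl(1-\frac{R'(1-\lambda(\epsilon))}{R'(1)}\Bigr)\Bigr).$$ Consequently, for this lower bound to tend to zero at a fixed erasure probability $\epsilon$, it is necessary that $R'(1)$ tend to infinity.
   Context: The LDGM ensemble with $m$ information bits and $n$ generator nodes is constructed as follows. The information bits $u_1,\dots,u_m$ are i.i.d. uniform in $\{0,1\}$. Each generator node independently chooses a degree $d$ with probability $R_d$ and a uniformly random $d$-subset $\{i_1,\dots,i_d\}$ of the information bits. It outputs $u_{i_1}+\dots+u_{i_d} \pmod 2$, which is sent through a BEC($\epsilon$). The limit $m,n\to\infty$ is taken with $n/m$ fixed. In this limit the information-bit degree distribution is Poisson with node-perspective generating function $\lambda(x)=e^{l_{\mathrm{avg}}(x-1)}$, $l_{\mathrm{avg}}=\frac{n}{m}R'(1)$. The error floor $P_e$ is the asymptotic (as $m\to\infty$) bit error probability of the information bits under belief-propagation (peeling) decoding run until no further progress is possible. Information bits that remain undetermined are guessed uniformly at random. *)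

(* Defs.v *)
From HB Require Import structures.
From mathcomp Require Import all_boot all_order all_algebra.
From mathcomp Require Import reals.
From mathcomp Require Import sequences exp.
Set Implicit Arguments. Unset Strict Implicit. Unset Printing Implicit Defensive.
Import Order.TTheory GRing.Theory Num.Theory.
Local Open Scope ring_scope.

Definition deg_dist (R : realType) (dmax : nat) (Rc : nat -> R) : Prop :=
  [/\ Rc 0%N = 0, (forall d, (dmax < d)%N -> Rc d = 0),
      (forall d, 0 <= Rc d) & \sum_(d < dmax.+1) Rc d = 1].

Definition Rprime (R : realType) (dmax : nat) (Rc : nat -> R) (x : R) : R :=
  \sum_(d < dmax.+1) (d%:R * Rc d * x ^+ d.-1).

(* l_avg = (n/m) R'(1) = R'(1)/r  with r = m/n *)
Definition lavg (R : realType) (r : R) (dmax : nat) (Rc : nat -> R) : R :=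
  Rprime dmax Rc 1 / r.

Definition lambda (R : realType) (r : R) (dmax : nat) (Rc : nat -> R) (x : R) : R :=
  expR (lavg r dmax Rc * (x - 1)).

Definition floor_bound (R : realType) (r eps : R) (dmax : nat) (Rc : nat -> R) : R :=
  2^-1 * lambda r dmax Rc eps *
  (1 + lavg r dmax Rc * (1 - eps) *
       (1 - Rprime dmax Rc (1 - lambda r dmax Rc eps) / Rprime dmax Rc 1)).

(* A sample: (information bits u, neighbourhoods S_j of the generator nodes,
   erasure pattern of the BEC, random guesses g for undetermined bits). *)
Definition config (m n : nat) : finType :=
  ({ffun 'I_m -> bool} * {ffun 'I_n -> {set 'I_m}} *
   {ffun 'I_n -> bool} * {ffun 'I_m -> bool})%type.

Definition cfg_u m n (c : config m n) : {ffun 'I_m -> bool} := c.1.1.1.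
Definition cfg_S m n (c : config m n) : {ffun 'I_n -> {set 'I_m}} := c.1.1.2.
Definition cfg_er m n (c : config m n) : {ffun 'I_n -> bool} := c.1.2.
Definition cfg_g m n (c : config m n) : {ffun 'I_m -> bool} := c.2.

(* Probability of a sample: u uniform, each generator node independently picks
   degree d w.p. R_d and a uniform d-subset, each output erased w.p. eps,
   guesses uniform. *)
Definition ens_weight (R : realType) (m n : nat) (Rc : nat -> R) (eps : R)
    (c : config m n) : R :=
  (2 ^- m) *
  (\prod_(j < n) (Rc #|cfg_S c j| / ('C(m, #|cfg_S c j|))%:R)) *
  (\prod_(j < n) (if cfg_er c j then eps else 1 - eps)) *
  (2 ^- m).

Definition parity m (S : {set 'I_m}) (u : {ffun 'I_m -> bool}) : bool :=
  \big[addb/false]_(k in S) u k.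

Definition chan_out m n (c : config m n) : {ffun 'I_n -> option bool} :=
  [ffun j => if cfg_er c j then None else Some (parity (cfg_S c j) (cfg_u c))].

Definition peel_step m n (S : {ffun 'I_n -> {set 'I_m}})
    (y : {ffun 'I_n -> option bool}) (x : {ffun 'I_m -> option bool})
    : {ffun 'I_m -> option bool} :=
  [ffun i => if x i is Some b then Some b else
     match [pick j | [&& y j != None, i \in S j &
                         [forall k in S j, (k != i) ==> (x k != None)]]] with
     | Some j => Some (addb (odflt false (y j))
                            (\big[addb/false]_(k in S j | k != i) odflt false (x k)))
     | None => None
     end].

(* Peeling run until no further progress (m rounds suffice: every round that
   makes progress determines at least one new bit). *)
Definition peel_decode m n (c : config m n) : {ffun 'I_m -> option bool} :=
  iter m (peel_step (cfg_S c) (chan_out c)) [ffun => None].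

Definition estimate m n (c : config m n) : {ffun 'I_m -> bool} :=
  [ffun i => if peel_decode c i is Some b then b else cfg_g c i].

Definition bit_error_prob (R : realType) (m n : nat) (Rc : nat -> R) (eps : R) : R :=
  (m%:R)^-1 * \sum_(i < m) \sum_(c : config m n)
     ens_weight Rc eps c * (estimate c i != cfg_u c i)%:R.

(* Main.v *)
Require Import Defs.
From HB Require Import structures.
From mathcomp Require Import all_boot all_order all_algebra.
From mathcomp Require Import ring.
From mathcomp Require Import reals topology normedtype.
From mathcomp Require Import sequences exp.
Import Order.TTheory GRing.Theory Num.Theory.
Import numFieldNormedType.Exports.
Set Implicit Arguments.
Unset Strict Implicit.
Local Open Scope ring_scope.

(** Two configurations are stopping sets for the peeling decoder at bit [i]: no
received generator node contains [i], or exactly one node [j0] does and [j0] also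
contains some [k != i] lying in no other received node. In both cases [i] stays
undetermined and its guess is wrong with probability 1/2.

By independence of the nodes, the probability that no received node meets a fixed
set of [s] bits is [q_s ^ n] with [q_s] the probability that one node misses it, and
[n (1 - q_s) -> s l_avg (1 - eps)], so [q_s ^ n -> lambda(eps) ^ s]. The first
configuration thus has limiting probability [lambda(eps)]. For the second one, when
[j0] has degree [d], inclusion-exclusion over the set of other bits of [j0] missed by
all other nodes gives
[lambda - sum_t C(d-1, t) (-1)^t lambda^(t+1) = lambda (1 - (1 - lambda)^(d-1))];
summing over [j0] and [d] produces [R'(1 - lambda)].

For the second part, the bound is at least [lambda(eps) / 2], which depends only on
[R'(1)] and stays away from [0] when [R'(1)] is bounded. *)

(** * Finite sums: indicators, grouping by cardinality, inclusion-exclusion, product weights *)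

Lemma prodr_bool (R : comPzSemiRingType) (I : finType) (P b : pred I) :
  \prod_(i | P i) (b i)%:R = [forall (i | P i), b i]%:R :> R.
Proof.
case: (boolP [forall (i | P i), b i]) => [/forallP h|].
  by rewrite big1 // => i Pi; have := h i; rewrite Pi /= => ->.
case/forallPn => i; rewrite negb_imply => /andP[Pi /negbTE nb].
by rewrite (bigD1 i) //= nb mul0r.
Qed.

Lemma sum_by_card (R : pzSemiRingType) (T : finType) (P : pred {set T}) (N : nat)
    (f : nat -> R) : (forall S, P S -> #|S| <= N)%N ->
  \sum_(S | P S) f #|S| =
  \sum_(d < N.+1) f d *+ #|[set S : {set T} | P S & #|S| == d]|.
Proof.
move=> hN; rewrite (partition_big (fun S : {set T} => inord #|S| : 'I_N.+1) predT) //=.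
apply: eq_bigr => d _; rewrite -sumr_const.
apply: congr_big => // [S|S /andP[PS /eqP <-]]; last by rewrite inordK // ltnS hN.
rewrite inE; case PS: (P S) => //=.
by rewrite -val_eqE /= inordK // ltnS hN.
Qed.

Lemma sum_subsets (R : pzSemiRingType) (T : finType) (A : {set T}) (f : nat -> R) :
  \sum_(U : {set T} | U \subset A) f #|U| =
  \sum_(t < #|A|.+1) f t *+ 'C(#|A|, t).
Proof.
rewrite (@sum_by_card _ _ _ #|A|) => [|S]; last exact: subset_leq_card.
by apply: eq_bigr => t _; rewrite cards_draws.
Qed.

(** The product of [1 - N k] over [k] in [A] indicates that no element of [A] satisfies [N]; the sum
    over [U] is its expansion. *)
Lemma inclusion_exclusion (R : comPzRingType) (T : finType) (A : {set T}) (N : pred T) :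
  [exists k in A, N k]%:R =
  1 - \sum_(U : {set T} | U \subset A) (-1) ^+ #|U| * \prod_(k in U) (N k)%:R :> R.
Proof.
suff -> : \sum_(U : {set T} | U \subset A) (-1) ^+ #|U| * \prod_(k in U) (N k)%:R
    = (~~ [exists k in A, N k])%:R :> R.
  by case: [exists k in A, N k]; rewrite ?subr0 ?subrr.
rewrite negb_exists; under eq_forallb do rewrite negb_and -implybE.
rewrite -prodr_bool [RHS]big_mkcond /=.
(* The product is extended to all of [T] so that distributivity yields a sum over all subsets. The
   summand 0 outside [A] kills every [U] not contained in [A]. *)
transitivity (\prod_k ((if k \in A then - (N k)%:R else 0) + 1) : R); last first.
  apply: eq_bigr => k _; case: (k \in A); last by rewrite add0r.
  by case: (N k); rewrite /= ?addNr ?oppr0 ?add0r.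
symmetry; rewrite bigA_distr (bigID (fun U : {set T} => U \subset A)) /= [X in _ + X]big1 ?addr0.
  apply: eq_bigr => U /subsetP sUA; rewrite -prodrN [RHS]big_mkcond /=.
  by apply: eq_bigr => k _; case: ifP => // /sUA ->.
by move=> U /subsetPn[k kU /negbTE nk]; rewrite (bigD1 k) //= kU nk mul0r.
Qed.

(** Independence of the nodes: the expectation of a product of per-node statistics factorises. *)
Lemma sum_nodes (R : comPzSemiRingType) (I T E : finType) (F : I -> T -> E -> R) :
  \sum_(S : {ffun I -> T}) \sum_(er : {ffun I -> E}) \prod_j F j (S j) (er j) =
  \prod_j \sum_s \sum_e F j s e.
Proof.
by rewrite bigA_distr_bigA; apply: eq_bigr => S _; rewrite bigA_distr_bigA.
Qed.

(** Independence with one distinguished node [j0]: it carries the statistic [A], and the other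
    [#|I|.-1] nodes contribute identical factors. *)
Lemma sum_nodes_at (R : comPzSemiRingType) (I T E : finType) (w A B : T -> E -> R)
    (j0 : I) :
  \sum_(S : {ffun I -> T}) \sum_(er : {ffun I -> E}) (\prod_j w (S j) (er j)) *
     (A (S j0) (er j0) * \prod_(j | j != j0) B (S j) (er j)) =
  (\sum_s \sum_e w s e * A s e) * (\sum_s \sum_e w s e * B s e) ^+ #|I|.-1.
Proof.
transitivity (\sum_(S : {ffun I -> T}) \sum_(er : {ffun I -> E})
    \prod_j (w (S j) (er j) * (if j == j0 then A (S j) (er j) else B (S j) (er j)))).
  apply: eq_bigr => S _; apply: eq_bigr => er _; rewrite big_split /=; congr (_ * _).
  rewrite [RHS](bigD1 j0) //= eqxx; congr (_ * _).
  by apply: eq_bigr => j /negbTE ->.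
rewrite (sum_nodes (fun j s e => w s e * (if j == j0 then A s e else B s e))).
rewrite (bigD1 j0) //= eqxx; congr (_ * _).
have <- : #|predC1 j0| = #|I|.-1 by rewrite cardC1.
rewrite -prodr_const.
by apply: eq_big => [j|j /negbTE ->].
Qed.

(** * Stopping sets *)

(* The hypothesis says that [V] is a stopping set. *)
Lemma peel_decode_stopping (m n : nat) (c : config m n) (V : {set 'I_m}) :
  (forall j i, ~~ cfg_er c j -> i \in cfg_S c j -> i \in V ->
     exists2 k, k \in cfg_S c j :&: V & k != i) ->
  forall i, i \in V -> peel_decode c i = None.
Proof.
move=> hV; rewrite /peel_decode; move: (X in iter X) => t; elim: t => [|t IH] i iV.
  by rewrite /= ffunE.
rewrite iterS; set x := iter _ _ _ in IH *.
rewrite /peel_step ffunE IH //; case: pickP => // j /and3P[].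
rewrite /chan_out ffunE; case: ifPn => // ner _ iS /forallP h.
have [k /setIP[kS kV] ki] := hV j i ner iS iV.
by have := h k; rewrite kS ki IH.
Qed.

Definition untouched (m n : nat) (S : {ffun 'I_n -> {set 'I_m}})
    (er : {ffun 'I_n -> bool}) (i : 'I_m) : bool :=
  [forall j, er j || (i \notin S j)].

Definition uncovered (m n : nat) (S : {ffun 'I_n -> {set 'I_m}})
    (er : {ffun 'I_n -> bool}) (j0 : 'I_n) (k : 'I_m) : bool :=
  [forall (j | j != j0), er j || (k \notin S j)].

Definition paired (m n : nat) (S : {ffun 'I_n -> {set 'I_m}})
    (er : {ffun 'I_n -> bool}) (i : 'I_m) (j0 : 'I_n) : bool :=
  [&& ~~ er j0 && (i \in S j0), uncovered S er j0 i
    & [exists k in S j0 :\ i, uncovered S er j0 k]].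

Lemma untouched_stuck (m n : nat) (c : config m n) (i : 'I_m) :
  untouched (cfg_S c) (cfg_er c) i -> peel_decode c i = None.
Proof.
move=> /forallP h; apply: (@peel_decode_stopping _ _ _ [set i]); last by rewrite inE.
move=> j k ner kS /set1P ki; move: kS; rewrite ki => iS.
by have := h j; rewrite (negbTE ner) iS.
Qed.

Lemma paired_stuck (m n : nat) (c : config m n) (i : 'I_m) (j0 : 'I_n) :
  paired (cfg_S c) (cfg_er c) i j0 -> peel_decode c i = None.
Proof.
case/and3P => /andP[ner0 iS0] /forallP ui /exists_inP[k /setD1P[ki kS0] /forallP uk].
apply: (@peel_decode_stopping _ _ _ [set i; k]); last by rewrite !inE eqxx.
move=> j l ner lS lV.
(* Both [i] and [k] are uncovered away from [j0], so no other received node meets the pair; [j0]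
   contains both. *)
have -> : j = j0.
  apply/eqP/idPn => jj0; have := ui j; have := uk j.
  rewrite jj0 (negbTE ner) /= => nk ni.
  by case/set2P: lV => e; rewrite e ?(negbTE nk) ?(negbTE ni) in lS.
case/set2P: lV => ->; [exists k | exists i]; rewrite ?inE ?eqxx ?orbT ?kS0 ?iS0 //.
by rewrite eq_sym.
Qed.

(** The events are mutually exclusive, so their indicators may be added: a pairing node is a
    received node containing [i], which contradicts [untouched], and [uncovered] forbids a second
    such node. *)
Lemma stuck_indicator (R : realType) (m n : nat) (c : config m n) (i : 'I_m) :
  ((untouched (cfg_S c) (cfg_er c) i)%:R +
   \sum_(j0 < n) (paired (cfg_S c) (cfg_er c) i j0)%:R) <=
  (peel_decode c i == None)%:R :> R.
Proof.
case: (boolP (untouched _ _ _)) => [iso|niso].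
  rewrite (untouched_stuck iso) big1 ?addr0 // => j0 _.
  move/forallP: iso => /(_ j0); rewrite /paired.
  by case: (cfg_er c j0) => //= /negbTE ->.
rewrite add0r; case: (boolP [exists j0, paired (cfg_S c) (cfg_er c) i j0]).
  case/existsP => j0 p0; rewrite (paired_stuck p0) (bigD1 j0) //= p0 big1 ?addr0 // => j jj0.
  case/and3P: p0 => _ /forallP /(_ j); rewrite jj0 /= /paired => h _.
  by case/orP: h => [->|/negbTE ->]; rewrite ?andbF.
by move/existsPn => h; rewrite big1 // => j _; rewrite (negbTE (h j)).
Qed.

(** * Expectations over the ensemble *)

Definition node_weight (R : realType) (m : nat) (Rc : nat -> R) (eps : R)
    (S : {set 'I_m}) (e : bool) : R :=
  Rc #|S| / 'C(m, #|S|)%:R * (if e then eps else 1 - eps).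

(** The guess at [i] is uniform and independent of everything else, hence wrong with probability 1/2
    for every [u]. Summing out [g] and then [u] leaves only the graph and the erasures. *)
Lemma sum_config (R : realType) (m n : nat) (Rc : nat -> R) (eps : R) (i : 'I_m)
    (Z : {ffun 'I_n -> {set 'I_m}} -> {ffun 'I_n -> bool} -> R) :
  \sum_(c : config m n) ens_weight Rc eps c *
     (Z (cfg_S c) (cfg_er c) * (cfg_g c i != cfg_u c i)%:R) =
  2^-1 * \sum_(S : {ffun 'I_n -> {set 'I_m}}) \sum_(er : {ffun 'I_n -> bool})
     (\prod_j node_weight Rc eps (S j) (er j)) * Z S er.
Proof.
(* The sum over [g] factorises over coordinates: each [k != i] contributes 1, and at [i] exactly one
   of the two values is wrong. *)
have guess : forall u : {ffun 'I_m -> bool},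
    \sum_(g : {ffun 'I_m -> bool}) 2 ^- m * (g i != u i)%:R = 2^-1 :> R.
  move=> u; transitivity (\sum_(g : {ffun 'I_m -> bool})
      \prod_(k < m) (2^-1 * (if k == i then (g k != u k)%:R else 1)) : R).
    apply: eq_bigr => g _; rewrite big_split /= prodr_const card_ord exprVn.
    congr (_ * _); rewrite (bigD1 i) //= eqxx big1 ?mulr1 //.
    by move=> k /negbTE ->.
  rewrite -(bigA_distr_bigA (fun k b => 2^-1 * (if k == i then (b != u k)%:R else 1))).
  rewrite (bigD1 i) //= eqxx [X in _ * X]big1 ?mulr1 => [|k /negbTE ->]; rewrite big_bool /=.
    by case: (u i); rewrite /= mulr1 mulr0 ?addr0 ?add0r.
  by rewrite mulr1; field.
have nuni : \sum_(u : {ffun 'I_m -> bool}) 2 ^- m = 1 :> R.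
  rewrite sumr_const card_ffun card_bool card_ord -(mulr_natr (2 ^- m)) natrX mulVf //.
  by rewrite expf_neq0 // pnatr_eq0.
pose f (u : {ffun 'I_m -> bool}) (S : {ffun 'I_n -> {set 'I_m}})
    (er : {ffun 'I_n -> bool}) (g : {ffun 'I_m -> bool}) : R :=
  2 ^- m * ((\prod_j node_weight Rc eps (S j) (er j)) * Z S er) *
  (2 ^- m * (g i != u i)%:R).
transitivity (\sum_(u : {ffun 'I_m -> bool}) \sum_(S : {ffun 'I_n -> {set 'I_m}})
    \sum_(er : {ffun 'I_n -> bool}) \sum_(g : {ffun 'I_m -> bool}) f u S er g).
  rewrite !pair_bigA /=; apply: eq_bigr => -[[[u S] er] g] _.
  rewrite /ens_weight /cfg_S /cfg_er /cfg_u /cfg_g /f /=.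
  rewrite [\prod_j node_weight _ _ _ _]big_split /=.
  by ring.
transitivity (\sum_(u : {ffun 'I_m -> bool}) 2 ^- m * (2^-1 *
   \sum_(S : {ffun 'I_n -> {set 'I_m}}) \sum_(er : {ffun 'I_n -> bool})
     (\prod_j node_weight Rc eps (S j) (er j)) * Z S er)); last first.
  by rewrite -mulr_suml nuni mul1r.
apply: eq_bigr => u _; rewrite mulrA mulr_sumr; apply: eq_bigr => S _.
rewrite mulr_sumr; apply: eq_bigr => er _.
by rewrite /f -mulr_sumr guess; ring.
Qed.

(** Only errors on undetermined bits are counted, where the estimate is the guess; a determined bit
    contributes at least 0. *)
Lemma bit_error_ge (R : realType) (m n dmax : nat) (Rc : nat -> R) (eps : R) :
  deg_dist dmax Rc -> 0 <= eps -> eps <= 1 ->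
  m%:R^-1 * \sum_(i < m) (2^-1 *
     \sum_(S : {ffun 'I_n -> {set 'I_m}}) \sum_(er : {ffun 'I_n -> bool})
     (\prod_j node_weight Rc eps (S j) (er j)) *
     ((untouched S er i)%:R + \sum_(j0 < n) (paired S er i j0)%:R))
  <= bit_error_prob m n Rc eps.
Proof.
move=> [_ _ Rge0 _] e0 e1; rewrite /bit_error_prob ler_wpM2l ?invr_ge0 ?ler0n //.
apply: ler_sum => i _.
rewrite -(sum_config Rc eps i (fun S er =>
  (untouched S er i)%:R + \sum_(j0 < n) (paired S er i j0)%:R)).
apply: ler_sum => c _.
apply: ler_wpM2l.
  rewrite /ens_weight !mulr_ge0 ?invr_ge0 ?exprn_ge0 ?ler0n //.
    by apply: prodr_ge0 => j _; rewrite divr_ge0 ?ler0n.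
  by apply: prodr_ge0 => j _; case: ifP => _ //; rewrite subr_ge0.
apply: le_trans (_ : (peel_decode c i == None)%:R * (cfg_g c i != cfg_u c i)%:R <= _).
  by rewrite ler_wpM2r ?ler0n // stuck_indicator.
rewrite /estimate ffunE; case: (peel_decode c i) => [b|] /=; first by rewrite mul0r ler0n.
by rewrite mul1r.
Qed.

(** Inclusion-exclusion over the sets [U] of other bits of [j0] that are uncovered. Each term is a
    statistic of [j0] times a product over the other nodes, the form required by [sum_nodes_at]. *)
Lemma paired_expand (R : comPzRingType) (m n : nat) (S : {ffun 'I_n -> {set 'I_m}})
    (er : {ffun 'I_n -> bool}) (i : 'I_m) (j0 : 'I_n) :
  (paired S er i j0)%:R =
  (~~ er j0 && (i \in S j0))%:R *
     \prod_(j | j != j0) (er j || [disjoint S j & [set i]])%:R -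
  \sum_(U : {set 'I_m}) (-1) ^+ #|U| *
    ((~~ er j0 && (i \in S j0) && (U \subset S j0 :\ i))%:R *
     \prod_(j | j != j0) (er j || [disjoint S j & i |: U])%:R) :> R.
Proof.
have cover (V : {set 'I_m}) : \prod_(j | j != j0) (er j || [disjoint S j & V])%:R =
    \prod_(k in V) (uncovered S er j0 k)%:R :> R.
  rewrite !prodr_bool; congr (nat_of_bool _)%:R; apply/idP/idP.
    move=> /forallP h; apply/forall_inP => k kV; apply/forall_inP => j jj0.
    have := h j; rewrite jj0 /=; case: (er j) => //=.
    by rewrite disjoint_sym => /disjointFr ->.
  move=> /forall_inP h; apply/forall_inP => j jj0; case ej: (er j) => //=.
  rewrite disjoint_sym disjoint_subset; apply/subsetP => k /h /forall_inP /(_ j jj0).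
  by rewrite ej.
have -> : (paired S er i j0)%:R = (~~ er j0 && (i \in S j0))%:R *
    ((uncovered S er j0 i)%:R *
     [exists k in S j0 :\ i, uncovered S er j0 k]%:R) :> R.
  by rewrite /paired -!natrM !mulnb.
rewrite inclusion_exclusion cover big_set1 !mulrBr mulr1; congr (_ - _).
rewrite [in LHS]big_mkcond /= !mulr_sumr; apply: eq_bigr => U _.
rewrite cover; case: ifPn => [sU|_]; last by rewrite andbF !(mulr0, mul0r).
have iU : i \notin U by apply/negP => /(subsetP sU); rewrite !inE eqxx.
by rewrite andbT big_setU1 //=; ring.
Qed.

(** This is [q_s]: a node is harmless to [s] fixed bits if it is erased, or received with its [d]
    neighbours among the remaining [m - s] bits. *)
Definition miss_prob (R : realType) (dmax : nat) (Rc : nat -> R) (eps : R) (m s : nat) : R :=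
  eps + (1 - eps) * \sum_(d < dmax.+1) Rc d * ('C(m - s, d)%:R / 'C(m, d)%:R).

(** Neighbourhoods are grouped by size up to [m]; sizes above [dmax] carry no weight. *)
Lemma sum_degrees (R : realType) (m dmax : nat) (Rc : nat -> R) (P : pred {set 'I_m})
    (f : nat -> R) : deg_dist dmax Rc -> (dmax <= m)%N ->
  \sum_(S | P S) Rc #|S| / 'C(m, #|S|)%:R * f #|S| =
  \sum_(d < dmax.+1) Rc d *
    (#|[set S : {set 'I_m} | P S & #|S| == d]|%:R / 'C(m, d)%:R) * f d.
Proof.
move=> [_ Rc0 _ _] dm.
rewrite (sum_by_card (N := m) (fun d => Rc d / 'C(m, d)%:R * f d)); last first.
  by move=> S _; rewrite -[X in (_ <= X)%N]card_ord max_card.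
pose F d := Rc d * (#|[set S : {set 'I_m} | P S & #|S| == d]|%:R / 'C(m, d)%:R) * f d.
transitivity (\sum_(0 <= d < m.+1) F d).
  rewrite big_mkord; apply: eq_bigr => d _.
  by rewrite /F -mulr_natr; ring.
rewrite -(big_mkord predT F) (big_cat_nat (n := dmax.+1)) //=.
rewrite [X in _ + X]big_nat_cond [X in _ + X]big1 ?addr0 // => d /andP[/andP[dd _] _].
by rewrite /F Rc0 // !mul0r.
Qed.

Lemma node_weight_miss (R : realType) (m dmax : nat) (Rc : nat -> R) (eps : R)
    (V : {set 'I_m}) : deg_dist dmax Rc -> (dmax <= m)%N ->
  \sum_(S : {set 'I_m}) \sum_(e : bool)
     node_weight Rc eps S e * (e || [disjoint S & V])%:R =
  miss_prob dmax Rc eps m #|V|.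
Proof.
move=> hR dm.
transitivity (\sum_(S : {set 'I_m}) Rc #|S| / 'C(m, #|S|)%:R * eps +
   \sum_(S : {set 'I_m} | S \subset ~: V) Rc #|S| / 'C(m, #|S|)%:R * (1 - eps)).
  rewrite [X in _ + X]big_mkcond -big_split /=; apply: eq_bigr => S _.
  rewrite big_bool /node_weight /= mulr1 subsets_disjoint setCK.
  by case: ifP => _; rewrite ?mulr1 ?mulr0.
rewrite (sum_degrees _ (fun _ => eps) hR dm) (sum_degrees _ (fun _ => 1 - eps) hR dm).
rewrite /miss_prob; congr (_ + _).
  rewrite -mulr_suml -[RHS]mul1r; congr (_ * _).
  case: hR => _ _ _ R1; apply: etrans R1; apply: eq_bigr => d _.
  have -> : [set S : {set 'I_m} | true & #|S| == d] =
      [set S : {set 'I_m} | S \subset [set: 'I_m] & #|S| == d].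
    by apply/setP => S; rewrite !inE subsetT.
  rewrite cards_draws cardsT card_ord divff ?mulr1 // pnatr_eq0 -lt0n bin_gt0.
  by apply: leq_trans dm; rewrite -ltnS.
rewrite -mulr_suml mulrC; congr (_ * _); apply: eq_bigr => d _.
by rewrite cards_draws cardsCs setCK card_ord.
Qed.

(** Pascal's rule: the subsets avoiding [i] are removed from all subsets of that size. *)
Lemma card_draws_mem (m d : nat) (i : 'I_m) :
  #|[set S : {set 'I_m} | i \in S & #|S| == d.+1]| = 'C(m.-1, d).
Proof.
have hm : m = m.-1.+1 by rewrite prednK // (leq_ltn_trans _ (ltn_ord i)).
have tot : #|[set S : {set 'I_m} | #|S| == d.+1]| = 'C(m, d.+1).
  have := cards_draws [set: 'I_m] d.+1; rewrite cardsT card_ord => <-.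
  by apply: eq_card => S; rewrite !inE subsetT.
have out : #|[set S : {set 'I_m} | S \subset [set~ i] & #|S| == d.+1]| = 'C(m.-1, d.+1).
  by rewrite cards_draws cardsC1 card_ord.
have pascal : 'C(m, d.+1) = ('C(m.-1, d.+1) + 'C(m.-1, d))%N by rewrite {1}hm binS.
apply/eqP; rewrite -(eqn_add2l 'C(m.-1, d.+1)) -pascal -tot -out.
rewrite -(cardsID [set S : {set 'I_m} | i \in S] [set S : {set 'I_m} | #|S| == d.+1]).
rewrite [eqbRHS]addnC; apply/eqP; congr (_ + _)%N; apply: eq_card => S; rewrite !inE.
  by rewrite subsetC sub1set inE.
by rewrite andbC.
Qed.

(** A uniform [d]-subset of the [m] bits contains [i] with probability [d / m]. *)
Lemma node_weight_hit (R : realType) (m dmax : nat) (Rc : nat -> R) (eps : R)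
    (i : 'I_m) (f : nat -> R) : deg_dist dmax Rc -> (dmax <= m)%N ->
  \sum_(S : {set 'I_m}) \sum_(e : bool)
     node_weight Rc eps S e * ((~~ e && (i \in S))%:R * f #|S|) =
  (1 - eps) * \sum_(d < dmax.+1) Rc d * (d%:R / m%:R) * f d.
Proof.
move=> hR dm.
transitivity (\sum_(S : {set 'I_m} | i \in S) Rc #|S| / 'C(m, #|S|)%:R * ((1 - eps) * f #|S|)).
  rewrite [RHS]big_mkcond; apply: eq_bigr => S _.
  rewrite big_bool /node_weight /= mul0r mulr0 add0r.
  by case: ifP => _; rewrite ?(mul1r, mul0r, mulr0) // mulrA.
rewrite (sum_degrees _ (fun d => (1 - eps) * f d) hR dm) mulr_sumr.
apply: eq_bigr => -[[|d] dd] _ /=.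
  by case: hR => -> _ _ _; rewrite !(mul0r, mulr0).
have m0 : (0 < m)%N by apply: leq_ltn_trans (ltn_ord i).
have md : (d.+1 <= m)%N by apply: leq_trans dm; rewrite -ltnS.
rewrite card_draws_mem.
have -> : 'C(m.-1, d)%:R / 'C(m, d.+1)%:R = d.+1%:R / m%:R :> R.
  apply/eqP; rewrite eqr_div ?pnatr_eq0 -?lt0n ?bin_gt0 // -!natrM eqr_nat mulnC.
  by rewrite mul_bin_diag.
by ring.
Qed.

(** Finite-size probability of the two stopping configurations at a bit. The factor [n] counts the
    choices of [j0], the exponent [n.-1] the other nodes, and [t] the size of a subset of the [d.-1]
    other bits of [j0]. *)
Definition stuck_prob (R : realType) (dmax : nat) (Rc : nat -> R) (eps : R) (m n : nat) : R :=
  miss_prob dmax Rc eps m 1 ^+ n +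
  n%:R * ((1 - eps) * \sum_(d < dmax.+1) Rc d * (d%:R / m%:R) *
    (miss_prob dmax Rc eps m 1 ^+ n.-1 -
     \sum_(t < d.-1.+1) ((-1) ^+ t * miss_prob dmax Rc eps m t.+1 ^+ n.-1) *+ 'C(d.-1, t))).

Lemma stuck_expectation (R : realType) (m n dmax : nat) (Rc : nat -> R) (eps : R)
    (i : 'I_m) : deg_dist dmax Rc -> (dmax <= m)%N ->
  \sum_(S : {ffun 'I_n -> {set 'I_m}}) \sum_(er : {ffun 'I_n -> bool})
     (\prod_j node_weight Rc eps (S j) (er j)) *
     ((untouched S er i)%:R + \sum_(j0 < n) (paired S er i j0)%:R) =
  stuck_prob dmax Rc eps m n.
Proof.
move=> hR dm; rewrite /stuck_prob; set q := miss_prob dmax Rc eps m.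
have miss V := node_weight_miss eps V hR dm.
transitivity (
  \sum_(S : {ffun 'I_n -> {set 'I_m}}) \sum_(er : {ffun 'I_n -> bool})
     (\prod_j node_weight Rc eps (S j) (er j)) * (untouched S er i)%:R +
  \sum_(j0 < n) \sum_(S : {ffun 'I_n -> {set 'I_m}}) \sum_(er : {ffun 'I_n -> bool})
     (\prod_j node_weight Rc eps (S j) (er j)) * (paired S er i j0)%:R).
  rewrite [X in _ = _ + X]exchange_big -big_split; apply: eq_bigr => S _ /=.
  rewrite [X in _ = _ + X]exchange_big -big_split; apply: eq_bigr => er _ /=.
  by rewrite mulrDr mulr_sumr.
congr (_ + _).
  transitivity (\sum_(S : {ffun 'I_n -> {set 'I_m}}) \sum_(er : {ffun 'I_n -> bool})
     \prod_j (node_weight Rc eps (S j) (er j) * (er j || [disjoint S j & [set i]])%:R)).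
    apply: eq_bigr => S _; apply: eq_bigr => er _.
    rewrite [RHS]big_split prodr_bool /=; congr (_ * (nat_of_bool _)%:R).
    by apply: eq_forallb => j; rewrite disjoint_sym disjoints1.
  rewrite (sum_nodes (fun _ s e => node_weight Rc eps s e * (e || [disjoint s & [set i]])%:R)).
  by rewrite (eq_bigr (fun _ => q 1%N)) ?prodr_const ?card_ord // => j _; rewrite miss cards1.
rewrite -[n in n%:R]card_ord mulrC mulr_natr -sumr_const; apply: eq_bigr => j0 _.
under eq_bigr => S _ do under eq_bigr => er _ do rewrite paired_expand mulrBr.
under eq_bigr => S _ do rewrite sumrB.
rewrite sumrB.
rewrite (sum_nodes_at (node_weight Rc eps) (fun s e => (~~ e && (i \in s))%:R)
  (fun s e => (e || [disjoint s & [set i]])%:R)) miss cards1 card_ord.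
(* [T s] is the alternating sum conditional on [j0] having neighbourhood [s]. The other nodes must
   miss the bits of [i |: U], whence the index [#|U|.+1]. *)
pose T (s : {set 'I_m}) := \sum_(U : {set 'I_m} | U \subset s :\ i)
  (-1) ^+ #|U| * q #|U|.+1 ^+ n.-1.
transitivity (\sum_(s : {set 'I_m}) \sum_(e : bool)
     node_weight Rc eps s e * ((~~ e && (i \in s))%:R * (q 1%N ^+ n.-1 - T s))).
  under [RHS]eq_bigr => s _ do under eq_bigr => e _ do rewrite mulrA mulrBr.
  under [RHS]eq_bigr => s _ do rewrite sumrB.
  rewrite sumrB; congr (_ - _).
    by rewrite mulr_suml; apply: eq_bigr => s _; rewrite mulr_suml.
  transitivity (\sum_(U : {set 'I_m}) (-1) ^+ #|U| *
     ((\sum_(s : {set 'I_m}) \sum_(e : bool) node_weight Rc eps s e *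
         (~~ e && (i \in s) && (U \subset s :\ i))%:R) *
      miss_prob dmax Rc eps m #|i |: U| ^+ n.-1)).
    under eq_bigr => S _ do under eq_bigr => er _ do rewrite mulr_sumr.
    under eq_bigr => S _ do rewrite exchange_big /=.
    rewrite exchange_big /=; apply: eq_bigr => U _.
    rewrite -miss -[in RHS](card_ord n).
    rewrite -(sum_nodes_at (node_weight Rc eps)
      (fun s e => (~~ e && (i \in s) && (U \subset s :\ i))%:R)
      (fun s e => (e || [disjoint s & i |: U])%:R) j0).
    rewrite mulr_sumr; apply: eq_bigr => S _; rewrite mulr_sumr; apply: eq_bigr => er _.
    exact: mulrCA.
  under eq_bigr => U _ do rewrite mulr_suml mulr_sumr.
  rewrite exchange_big /=; apply: eq_bigr => s _.
  under eq_bigr => U _ do rewrite mulr_suml mulr_sumr.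
  rewrite exchange_big /=; apply: eq_bigr => e _.
  rewrite mulr_sumr [RHS]big_mkcond; apply: eq_bigr => U _ /=.
  case: ifPn => [sU|_]; last by rewrite andbF !(mulr0, mul0r).
  have iU : i \notin U by apply/negP => /(subsetP sU); rewrite !inE eqxx.
  by rewrite andbT cardsU1 iU add1n /q; ring.
(* [T s] depends on [s] only through its degree, since [s :\ i] has [d.-1] elements when [i] is in
   [s]. *)
pose g d := q 1%N ^+ n.-1 - \sum_(t < d.-1.+1) ((-1) ^+ t * q t.+1 ^+ n.-1) *+ 'C(d.-1, t).
transitivity (\sum_(s : {set 'I_m}) \sum_(e : bool)
     node_weight Rc eps s e * ((~~ e && (i \in s))%:R * g #|s|)); last first.
  by rewrite (node_weight_hit eps i g hR dm).
apply: eq_bigr => s _; apply: eq_bigr => e _; case si: (i \in s); last by rewrite andbF !mul0r.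
rewrite /T (sum_subsets _ (fun t => (-1) ^+ t * q t.+1 ^+ n.-1)) /g.
by rewrite [#|s|](cardsD1 i) si add1n.
Qed.

Lemma bit_error_ge_stuck_prob (R : realType) (m n dmax : nat) (Rc : nat -> R) (eps : R) :
  deg_dist dmax Rc -> 0 <= eps -> eps <= 1 -> (dmax <= m)%N -> (0 < m)%N ->
  2^-1 * stuck_prob dmax Rc eps m n <= bit_error_prob m n Rc eps.
Proof.
move=> hR e0 e1 dm m0; apply: le_trans (bit_error_ge m n hR e0 e1).
under eq_bigr => i _ do rewrite (stuck_expectation n eps i hR dm).
by rewrite sumr_const card_ord -[X in _ <= _ * X]mulr_natl mulKf // pnatr_eq0 -lt0n.
Qed.

(** * Positivity of [R'(1)] and an elementary lower bound on the floor bound *)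

Lemma Rprime1_gt0 (R : realType) (dmax : nat) (Rc : nat -> R) :
  deg_dist dmax Rc -> 0 < Rprime dmax Rc 1.
Proof.
move=> [R0 _ Rge0 R1].
suff : \sum_(d < dmax.+1) Rc d <= Rprime dmax Rc 1 by rewrite R1; exact: lt_le_trans.
rewrite /Rprime; apply: ler_sum => d _; rewrite expr1n mulr1.
by case: d => -[|d] hd /=; rewrite ?R0 ?mulr0 // ler_peMl // ler1n.
Qed.

(** The bracket is at least 1: [R'] has nonnegative coefficients and [1 - lambda] lies in [[0, 1]],
    so [R'(1 - lambda)] is at most [R'(1)]. *)
Lemma floor_bound_ge (R : realType) (r eps : R) (dmax : nat) (Rc : nat -> R) :
  deg_dist dmax Rc -> 0 < r -> eps <= 1 ->
  2^-1 * lambda r dmax Rc eps <= floor_bound r eps dmax Rc.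
Proof.
move=> hR r0 e1; have Rp := Rprime1_gt0 hR.
have l0 : 0 <= lavg r dmax Rc by rewrite divr_ge0 ?ltW.
have lam1 : lambda r dmax Rc eps <= 1.
  by rewrite expR_le1 mulr_ge0_le0 // subr_le0.
rewrite /floor_bound ler_peMr ?mulr_ge0 ?invr_ge0 ?ler0n ?expR_ge0 //.
rewrite lerDl mulr_ge0 //; first by rewrite mulr_ge0 // subr_ge0.
rewrite subr_ge0 ler_pdivrMr // mul1r.
case: hR => _ _ Rge0 _; apply: ler_sum => d _.
rewrite ler_wpM2l ?mulr_ge0 // expr1n exprn_ile1 ?subr_ge0 //.
by rewrite gerBl expR_ge0.
Qed.

(** * Limits *)

Section Asymptotics.
Local Open Scope classical_set_scope.

Lemma cvg_near_ext (R : realType) (u v : nat -> R) (l : R) :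
  (\forall k \near \oo, u k = v k) -> u k @[k --> \oo] --> l -> v k @[k --> \oo] --> l.
Proof. by move=> uv; apply: cvg_trans; apply: near_eq_cvg. Qed.

Lemma cvg_sum (R : realType) (I : Type) (s : seq I) (P : pred I) (f : I -> nat -> R)
    (l : I -> R) : (forall i, P i -> f i k @[k --> \oo] --> l i) ->
  \sum_(i <- s | P i) f i k @[k --> \oo] --> \sum_(i <- s | P i) l i.
Proof. by move=> h; apply: cvg_big => //; exact: add_continuous. Qed.

(* Squeeze: [exp (- y / (1 - y)) <= 1 - y <= exp (- y)] for [y < 1]. *)
Lemma cvg_onem_exp (R : realType) (y : nat -> R) (n : nat -> nat) (c : R) :
  y k @[k --> \oo] --> 0 -> (n k)%:R * y k @[k --> \oo] --> c ->
  (1 - y k) ^+ n k @[k --> \oo] --> expR (- c).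
Proof.
move=> y0 nyc.
have oney : 1 - y k @[k --> \oo] --> (1 : R).
  by rewrite -[X in _ --> X]subr0; apply: cvgB => //; exact: cvg_cst.
apply: (@squeeze_cvgr _ _ _ _ (fun k => expR (- ((n k)%:R * y k / (1 - y k))))
   (fun k => expR (- ((n k)%:R * y k)))).
- have ylt : \forall k \near \oo, y k < 1.
    move/cvgrPdist_lt: y0 => /(_ 1 ltr01); apply: filterS => k.
    by rewrite sub0r normrN => /ltr_normlW.
  apply: filterS ylt => k yk.
  have y1 : 0 < 1 - y k by rewrite subr_gt0.
  rewrite -mulrA -!mulrN !expRM_natl; apply/andP; split.
    apply: lerXn2r; rewrite ?nnegrE ?expR_ge0 ?(ltW y1) //.
    rewrite -[leRHS]invrK mulrN expRN lef_pV2 ?posrE ?expR_gt0 ?invr_gt0 //.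
    apply: le_trans (expR_ge1Dx _); rewrite le_eqVlt; apply/orP; left; apply/eqP.
    by field; rewrite gt_eqF.
  apply: lerXn2r; rewrite ?nnegrE ?expR_ge0 ?(ltW y1) //.
  exact: expR_ge1Dx.
- apply: continuous_cvg; first exact: continuous_expR.
  apply: cvgN; rewrite -[X in _ --> X]mulr1; apply: cvgM => //.
  rewrite -[X in _ --> X]invr1; apply: cvgV => //; exact: oner_neq0.
- by apply: continuous_cvg; [exact: continuous_expR | exact: cvgN].
Qed.

Lemma cvg_natV (R : realType) (ms : nat -> nat) :
  (forall N, \forall k \near \oo, (N <= ms k)%N) ->
  (ms k)%:R^-1 @[k --> \oo] --> (0 : R).
Proof.
move=> hms.
apply/cvgrPdist_lt => e e0.
have := hms (Num.bound e^-1).+1; apply: filterS => k hk.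
have mpos : 0 < (ms k)%:R :> R by rewrite ltr0n (leq_trans _ hk).
rewrite sub0r normrN gtr0_norm ?invr_gt0 // invf_plt ?posrE //.
apply: lt_trans (archi_boundP _) _; first by rewrite invr_ge0 ltW.
by rewrite ltr_nat.
Qed.

(** Induction on [s]: excluding one more bit multiplies the ratio by [1 - d / (m - s)], which adds
    [d] to the limit because the ratio itself tends to 1. *)
Lemma cvg_bin_ratio (R : realType) (ms : nat -> nat) (d s : nat) :
  (forall N, \forall k \near \oo, (N <= ms k)%N) ->
  (ms k)%:R * (1 - 'C(ms k - s, d)%:R / 'C(ms k, d)%:R) @[k --> \oo] --> ((s * d)%:R : R).
Proof.
move=> hms.
have mV0 : (ms k)%:R^-1 @[k --> \oo] --> (0 : R) by exact: cvg_natV.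
elim: s => [|s IH].
  apply: cvg_near_ext (cvg_cst 0); have := hms d; apply: filterS => k hk.
  by rewrite subn0 divff ?subrr ?mulr0 // pnatr_eq0 -lt0n bin_gt0.
(* The induction hypothesis multiplied by [1 / m] shows that [1] minus the ratio tends to 0. *)
have ratio1 : 'C(ms k - s, d)%:R / 'C(ms k, d)%:R @[k --> \oo] --> (1 : R).
  rewrite -[X in _ --> X](subr0 1) -(mul0r (s * d)%:R).
  apply: (@cvg_near_ext _ (fun k => 1 - (ms k)%:R^-1 *
      ((ms k)%:R * (1 - 'C(ms k - s, d)%:R / 'C(ms k, d)%:R)))); last first.
    by apply: cvgB; [exact: cvg_cst | exact: cvgM].
  have := hms 1%N; apply: filterS => k hk /=.
  rewrite mulrA mulVf ?mul1r ?pnatr_eq0 -?lt0n //.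
  by rewrite opprB addrC subrK.
have shift : (1 - s%:R * (ms k)%:R^-1)^-1 @[k --> \oo] --> (1 : R).
  rewrite -[X in _ --> X]invr1; apply: cvgV; first exact: oner_neq0.
  rewrite -[X in _ --> X](subr0 1) -(mulr0 s%:R).
  by apply: cvgB; [exact: cvg_cst | apply: cvgM => //; exact: cvg_cst].
rewrite mulSn addnC natrD -[X in _ --> _ + X]mul1r -[X in _ --> _ + X]mulr1.
apply: (@cvg_near_ext _ (fun k =>
   (ms k)%:R * (1 - 'C(ms k - s, d)%:R / 'C(ms k, d)%:R) +
   'C(ms k - s, d)%:R / 'C(ms k, d)%:R * d%:R * (1 - s%:R * (ms k)%:R^-1)^-1)); last first.
  apply: cvgD IH _; apply: cvgM => //.
  by apply: cvgM => //; exact: cvg_cst.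
(* This threshold gives [s < m] and [d <= m - s], so the natural subtractions are exact and the
   denominators nonzero. *)
have := hms (s + d).+1; apply: filterS => k hk /=.
have mpos : (ms k)%:R != 0 :> R by rewrite pnatr_eq0 -lt0n (leq_trans _ hk).
have ms_s : (s < ms k)%N by apply: leq_trans hk; rewrite ltnS leq_addr.
have dms : (d <= ms k - s)%N by rewrite leq_subRL ?(ltnW ms_s) // ltnW.
have Cpos : 'C(ms k, d)%:R != 0 :> R.
  by rewrite pnatr_eq0 -lt0n bin_gt0 (leq_trans dms) // leq_subr.
have down : ((ms k)%:R - s%:R) * 'C(ms k - s.+1, d)%:R =
    ((ms k)%:R - s%:R - d%:R) * 'C(ms k - s, d)%:R :> R.
  rewrite -natrB ?(ltnW ms_s) // -natrB // -!natrM; congr _%:R.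
  by rewrite -mul_bin_down subnS.
have mspos : (ms k)%:R - s%:R != 0 :> R by rewrite subr_eq0 eqr_nat gtn_eqF.
have -> : 'C(ms k - s.+1, d)%:R = ((ms k)%:R - s%:R - d%:R) * 'C(ms k - s, d)%:R /
    ((ms k)%:R - s%:R) :> R by rewrite -down mulrC mulKf.
by field; rewrite mpos mspos Cpos.
Qed.

Lemma cvg_miss_prob (R : realType) (r eps : R) (dmax : nat) (Rc : nat -> R)
    (ms ns : nat -> nat) (s : nat) : deg_dist dmax Rc ->
  (forall N, \forall k \near \oo, (N <= ms k)%N) ->
  (ns k)%:R / (ms k)%:R @[k --> \oo] --> r^-1 ->
  (ns k)%:R * (1 - miss_prob dmax Rc eps (ms k) s) @[k --> \oo] -->
    s%:R * (lavg r dmax Rc * (1 - eps)).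
Proof.
move=> [_ _ _ R1] hms hnm.
apply: (@cvg_near_ext _ (fun k => (ns k)%:R / (ms k)%:R * ((1 - eps) *
   \sum_(d < dmax.+1) Rc d * ((ms k)%:R * (1 - 'C(ms k - s, d)%:R / 'C(ms k, d)%:R))))).
  have := hms 1%N; apply: filterS => k hk.
  have mpos : (ms k)%:R != 0 :> R by rewrite pnatr_eq0 -lt0n.
  have -> : 1 - miss_prob dmax Rc eps (ms k) s = (1 - eps) *
      \sum_(d < dmax.+1) Rc d * (1 - 'C(ms k - s, d)%:R / 'C(ms k, d)%:R).
    under eq_bigr => d _ do rewrite mulrBr mulr1.
    by rewrite sumrB R1 /miss_prob; ring.
  under eq_bigr => d _ do rewrite mulrCA.
  by rewrite -mulr_sumr; field.
have -> : s%:R * (lavg r dmax Rc * (1 - eps)) =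
    r^-1 * ((1 - eps) * \sum_(d < dmax.+1) Rc d * (s * d)%:R).
  rewrite /lavg /Rprime.
  under [in RHS]eq_bigr => d _ do rewrite natrM mulrCA.
  under [in LHS]eq_bigr => d _ do rewrite expr1n mulr1 mulrC.
  by rewrite -mulr_sumr; ring.
apply: cvgM => //; apply: cvgM; first exact: cvg_cst.
by apply: cvg_sum => d _; apply: cvgM; [exact: cvg_cst | exact: cvg_bin_ratio].
Qed.

(** Both exponents occur in [stuck_prob]. They give the same limit because [1 - q_s] tends to 0, so
    dropping one node does not change the limit of [n (1 - q_s)]. *)
Lemma cvg_miss_prob_pow (R : realType) (r eps : R) (dmax : nat) (Rc : nat -> R)
    (ms ns : nat -> nat) (s : nat) : deg_dist dmax Rc ->
  (forall N, \forall k \near \oo, (N <= ms k)%N) ->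
  (forall N, \forall k \near \oo, (N <= ns k)%N) ->
  (ns k)%:R^-1 @[k --> \oo] --> (0 : R) ->
  (ns k)%:R / (ms k)%:R @[k --> \oo] --> r^-1 ->
  miss_prob dmax Rc eps (ms k) s ^+ ns k @[k --> \oo] --> lambda r dmax Rc eps ^+ s /\
  miss_prob dmax Rc eps (ms k) s ^+ (ns k).-1 @[k --> \oo] --> lambda r dmax Rc eps ^+ s.
Proof.
move=> hR hms hns nV0 hnm.
pose y k := 1 - miss_prob dmax Rc eps (ms k) s.
have ny : (ns k)%:R * y k @[k --> \oo] --> s%:R * (lavg r dmax Rc * (1 - eps)).
  exact: cvg_miss_prob.
have y0 : y k @[k --> \oo] --> (0 : R).
  rewrite -[X in _ --> X](mul0r (s%:R * (lavg r dmax Rc * (1 - eps)))).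
  apply: (@cvg_near_ext _ (fun k => (ns k)%:R^-1 * ((ns k)%:R * y k))); last exact: cvgM.
  have := hns 1%N; apply: filterS => k hk.
  by rewrite mulKf // pnatr_eq0 -lt0n.
have -> : lambda r dmax Rc eps ^+ s = expR (- (s%:R * (lavg r dmax Rc * (1 - eps)))).
  by rewrite /lambda -mulrN -mulrN opprB expRM_natl.
have qE k : miss_prob dmax Rc eps (ms k) s = 1 - y k by rewrite /y subKr.
split; under boolp.eq_fun do rewrite qE; apply: cvg_onem_exp => //.
rewrite -[X in _ --> X]subr0.
apply: (@cvg_near_ext _ (fun k => (ns k)%:R * y k - y k)); last exact: cvgB.
have := hns 1%N; apply: filterS => k hk.
by rewrite -[in LHS](prednK hk) -natr1 mulrDl mul1r addrK.
Qed.

Lemma cvg_stuck_prob (R : realType) (r eps : R) (dmax : nat) (Rc : nat -> R)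
    (ms ns : nat -> nat) : deg_dist dmax Rc -> 0 < r ->
  (forall N, \forall k \near \oo, (N <= ms k)%N) ->
  (ms k)%:R / (ns k)%:R @[k --> \oo] --> r ->
  2^-1 * stuck_prob dmax Rc eps (ms k) (ns k) @[k --> \oo] --> floor_bound r eps dmax Rc.
Proof.
move=> hR r0 hms hmn.
have hnm : (ns k)%:R / (ms k)%:R @[k --> \oo] --> r^-1.
  apply: (@cvg_near_ext _ (fun k => ((ms k)%:R / (ns k)%:R)^-1)).
    by apply: nearW => k; rewrite invf_div.
  by apply: cvgV => //; rewrite gt_eqF.
have nV0 : (ns k)%:R^-1 @[k --> \oo] --> (0 : R).
  rewrite -[X in _ --> X](mulr0 r).
  apply: (@cvg_near_ext _ (fun k => (ms k)%:R / (ns k)%:R * (ms k)%:R^-1)).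
    have := hms 1%N; apply: filterS => k hk.
    by rewrite mulrAC divff ?mul1r // pnatr_eq0 -lt0n.
  by apply: cvgM => //; exact: cvg_natV.
(* Eventually [n / m > 1 / (2 r)] and [m > 2 r N], hence [n > N]. *)
have hns N : \forall k \near \oo, (N <= ns k)%N.
  have r2 : 0 < (2 * r)^-1 by rewrite invr_gt0 mulr_gt0.
  have close : \forall k \near \oo, (2 * r)^-1 < (ns k)%:R / (ms k)%:R.
    apply: (cvgr_gt r^-1 hnm).
    by rewrite ltf_pV2 ?posrE ?mulr_gt0 // -[ltLHS]mul1r ltr_pM2r // ltr1n.
  have large : \forall k \near \oo, N%:R * (2 * r) < (ms k)%:R.
    have := hms (Num.bound (N%:R * (2 * r))); apply: filterS => k hk.
    apply: lt_le_trans (archi_boundP _) _; last by rewrite ler_nat.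
    by rewrite !mulr_ge0 ?ler0n ?(ltW r0).
  apply: filterS2 close large => k ck lk.
  have mpos : 0 < (ms k)%:R :> R.
    by apply: le_lt_trans lk; rewrite !mulr_ge0 ?ler0n ?(ltW r0).
  rewrite -(ler_nat R) ltW //.
  move: ck; rewrite ltr_pdivlMr //; apply: lt_trans.
  by rewrite mulrC ltr_pdivlMr ?mulr_gt0.
have pow s := cvg_miss_prob_pow eps s hR hms hns nV0 hnm.
set lam := lambda r dmax Rc eps in pow *.
pose H k d := miss_prob dmax Rc eps (ms k) 1 ^+ (ns k).-1 -
   \sum_(t < d.-1.+1) ((-1) ^+ t * miss_prob dmax Rc eps (ms k) t.+1 ^+ (ns k).-1)
     *+ 'C(d.-1, t).
(* The limiting alternating sum is the binomial expansion of [lam * (1 - lam) ^+ d.-1], matched term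
   by term. *)
have cvgH d : H k d @[k --> \oo] --> lam - lam * (1 - lam) ^+ d.-1.
  rewrite exprBn mulr_sumr; apply: cvgB; first exact: (pow 1%N).2.
  apply: cvg_sum => t _.
  rewrite [X in _ --> X](_ : _ = (-1) ^+ t * lam ^+ t.+1 * 'C(d.-1, t)%:R); last first.
    by rewrite expr1n mulr1 exprS -mulr_natr; ring.
  under boolp.eq_fun do rewrite -mulr_natr.
  apply: cvgM; last exact: cvg_cst.
  by apply: cvgM; [exact: cvg_cst | exact: (pow t.+1).2].
apply: (@cvg_near_ext _ (fun k => 2^-1 * (miss_prob dmax Rc eps (ms k) 1 ^+ ns k +
   (ns k)%:R / (ms k)%:R * ((1 - eps) * \sum_(d < dmax.+1) Rc d * d%:R * H k d)))).
  apply: nearW => k; rewrite /stuck_prob; congr (_ * (_ + _)).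
  have -> : \sum_(d < dmax.+1) Rc d * (d%:R / (ms k)%:R) * H k d =
      (ms k)%:R^-1 * \sum_(d < dmax.+1) Rc d * d%:R * H k d.
    by rewrite mulr_sumr; apply: eq_bigr => d _; ring.
  by ring.
have Rp1 : Rprime dmax Rc 1 = \sum_(d < dmax.+1) Rc d * d%:R.
  by apply: eq_bigr => d _; rewrite expr1n mulr1 mulrC.
have RpP : 0 < Rprime dmax Rc 1 by exact: Rprime1_gt0.
have -> : floor_bound r eps dmax Rc = 2^-1 * (lam ^+ 1 + r^-1 * ((1 - eps) *
    \sum_(d < dmax.+1) Rc d * d%:R * (lam - lam * (1 - lam) ^+ d.-1))).
  have -> : \sum_(d < dmax.+1) Rc d * d%:R * (lam - lam * (1 - lam) ^+ d.-1) =
      lam * (Rprime dmax Rc 1 - Rprime dmax Rc (1 - lam)).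
    by rewrite Rp1 /Rprime -sumrB mulr_sumr; apply: eq_bigr => d _; ring.
  rewrite /floor_bound /lavg -/lam; field.
  by rewrite !gt_eqF.
apply: cvgM; first exact: cvg_cst.
apply: cvgD; first exact: (pow 1%N).1.
apply: cvgM => //; apply: cvgM; first exact: cvg_cst.
by apply: cvg_sum => d _; apply: cvgM; [exact: cvg_cst | exact: cvgH].
Qed.

Lemma bit_error_prob_liminf (R : realType) (r eps delta : R) (dmax : nat) (Rc : nat -> R)
    (ms ns : nat -> nat) : deg_dist dmax Rc -> 0 < r -> 0 <= eps -> eps <= 1 ->
  (forall N : nat, exists K : nat, forall k, (K <= k)%N -> (N <= ms k)%N) ->
  (forall e : R, 0 < e -> exists K : nat, forall k, (K <= k)%N ->
     `|(ms k)%:R / (ns k)%:R - r| < e) ->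
  0 < delta -> exists K : nat, forall k, (K <= k)%N ->
    floor_bound r eps dmax Rc - delta <= bit_error_prob (ms k) (ns k) Rc eps.
Proof.
move=> hR hr eps0 eps1 hms hmn delta0.
have hms' N : \forall k \near \oo, (N <= ms k)%N.
  by have [K hK] := hms N; exists K.
have hmn' : (ms k)%:R / (ns k)%:R @[k --> \oo] --> r.
  apply/cvgrPdist_lt => e e0; have [K hK] := hmn e e0.
  by exists K => // k /= Kk; rewrite distrC hK.
have /cvgrPdist_lt /(_ delta delta0) near_bound :=
  cvg_stuck_prob (eps := eps) hR hr hms' hmn'.
have [K _ hK] : (\forall k \near \oo,
    floor_bound r eps dmax Rc - delta <= bit_error_prob (ms k) (ns k) Rc eps).
  (* The finite-size bound needs [dmax <= m] and [0 < m], both of which hold eventually. *)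
  apply: filterS2 near_bound (hms' (maxn dmax 1)) => k hk mk.
  move: mk; rewrite geq_max => /andP[dm m0].
  apply: le_trans (bit_error_ge_stuck_prob (ns k) hR eps0 eps1 dm m0).
  by rewrite lerBlDl -lerBlDr ltW // ltr_normlW.
by exists K => k Kk; apply: hK.
Qed.

End Asymptotics.

Unset Implicit Arguments.
Set Strict Implicit.

Theorem mainTheorem2 (R : realType) (r eps : R) (hr : 0 < r)
    (heps0 : 0 < eps) (heps1 : eps < 1) :
  (* the error floor (asymptotic bit error probability, m -> oo, m/n -> r)
     is at least the bound: liminf of the bit error probability >= bound *)
  (forall (dmax : nat) (Rc : nat -> R), deg_dist dmax Rc ->
   forall (ms ns : nat -> nat),
     (forall N : nat, exists K : nat, forall k, (K <= k)%N -> (N <= ms k)%N) ->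
     (forall e : R, 0 < e -> exists K : nat, forall k, (K <= k)%N ->
        `|(ms k)%:R / (ns k)%:R - r| < e) ->
     forall delta : R, 0 < delta -> exists K : nat, forall k, (K <= k)%N ->
       floor_bound r eps dmax Rc - delta <= bit_error_prob (ms k) (ns k) Rc eps)
  /\
  (* consequently: along any sequence of degree distributions for which the
     bound tends to 0 (eps, r fixed), R'(1) tends to infinity *)
  (forall (dms : nat -> nat) (Rcs : nat -> nat -> R),
     (forall k, deg_dist (dms k) (Rcs k)) ->
     (forall e : R, 0 < e -> exists K : nat, forall k, (K <= k)%N ->
        floor_bound r eps (dms k) (Rcs k) < e) ->
     forall M : R, exists K : nat, forall k, (K <= k)%N ->
       M < Rprime (dms k) (Rcs k) 1).
Proof.
split=> [dmax Rc hR ms ns hms hmn delta delta0|dms Rcs hRs hb M].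
  exact: bit_error_prob_liminf (ltW heps0) (ltW heps1) hms hmn delta0.
(* The threshold is [lambda(eps) / 2] evaluated at [R'(1) = M]. As [lambda(eps)] decreases in
   [R'(1)], having [R'(1) <= M] would keep the floor bound at or above it. *)
have [|K hK] := hb (2^-1 * expR (M / r * (eps - 1))).
  by rewrite mulr_gt0 ?expR_gt0 ?invr_gt0 ?ltr0n.
exists K => k /hK; apply: contraLR; rewrite -!leNgt => RM.
apply: le_trans (floor_bound_ge (hRs k) hr (ltW heps1)).
rewrite ler_wpM2l ?invr_ge0 ?ler0n // ler_expR.
rewrite ler_wnM2r ?subr_le0 ?(ltW heps1) //.
by rewrite ler_wpM2r // invr_ge0 ltW.
Qed.
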